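(* Let $X$, $(P_t)_{t\ge0}$, $\mathscr G$ and $\tau$ satisfy the standing assumptions (1)–(5) listed in the context. Suppose that $P_t$ satisfies $\mathrm{(rAC)}_X$ (the asymptotic coupling property restricted to the action of $\mathscr G$ on the whole space $X$, with associated quantities $r(u_0)$ and $\varepsilon_0(u_0,g)$), and let $\mu,\nu$ be Radon probability measures on $X$ which are invariant for $P_t$ and such that $\mu\perp\nu$. Then there exist two disjoint sets $U_0,U_1\subseteq X$, both open with respect to the topology induced by $d_{\mathscr G}$ and measurable with respect to the Borel $\sigma$-algebra of $(X,d_X)$, such that $$\mu(U_0)=1,\ \nu(U_0)=0,\qquad \mu(U_1)=0,\ \nu(U_1)=1.$$ Moreover: (i) If $\varepsilon_0(u_0,g)<\frac12$ for every $u_0\in X$ and $|g|\le r(u_0)$, then the closures of $U_0,U_1$ in the topology induced by $d_{\mathscr G}$ are also disjoint. In particular, this holds if $P_t$ satisfies $\mathrm{(rASF)}_X$ (the asymptotic strong Feller property restricted to the action of $\mathscr G$ on $X$). (ii) If $r(u_0)=\infty$ for every $u_0\in X$, then $U_0$ can be chosen $\mathscr G$-invariant, i.e. $\tau(\mathscr G\times U_0)=U_0$, and $U_1=(U_0)^c$.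
   Context: Standing assumptions. (1) $X$ is a metric space with distance $d_X$, $\mathscr B(X)$ its Borel $\sigma$-algebra, and $\mathscr L^\infty(X)$ is the space of bounded Borel functions $X\to\mathbb R$ with the sup norm $\|\cdot\|_\infty$. (2) $(P_t)_{t\ge0}$ is a Markov semigroup on $\mathscr L^\infty(X)$: each $P_t$ is linear and bounded on $\mathscr L^\infty(X)$, $P_{t+s}=P_tP_s=P_sP_t$, $f\ge0$ implies $P_tf\ge0$, and $P_t\mathbb 1=\mathbb 1$. (3) $\mathscr G$ is a topological group with identity $e$, with a function $|\cdot|:\mathscr G\to\mathbb R$ such that $|g|\ge0$ with equality iff $g=e$, $|g^{-1}|=|g|$, $|g_1g_2|\le|g_1|+|g_2|$; the topology of $\mathscr G$ is induced by the distance $d_{\mathscr G}(g_1,g_2)=|g_1^{-1}g_2|$. $B_r=\{g\in\mathscr G:|g|\le r\}$ (with $B_\infty=\mathscr G$). (4) $\tau:\mathscr G\times X\to X$, $\tau_g(x)=\tau(g,x)$, is a group action: $\tau_e(x)=x$ and $\tau_{g_1g_2}(x)=\tau_{g_1}(\tau_{g_2}(x))$. (5) For every compact $K\subseteq X$, $\lim_{r\to0}\sup_{x\in K}\sup_{g\in B_r}d_X(x,\tau_g(x))=0$, and for every $r\ge0$ and compact $K\subseteq X$, $\tau(B_r\times K)\in\mathscr B(X)$. Induced distance. On $X$, $d_{\mathscr G}(u_1,u_2)=\inf\{|g|:g\in\mathscr G,\ u_1=\tau_g(u_2)\}\in[0,\infty]$ (with $\inf\emptyset=\infty$). For $\varphi:X\to\mathbb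 R$, $\|\varphi\|_{\mathscr G\text{-Lip}}=\sup_{u_1\ne u_2}\frac{|\varphi(u_1)-\varphi(u_2)|}{d_{\mathscr G}(u_1,u_2)}$. $\mathrm{(rASF)}_S$, for $S\subseteq X$: there exist times $t_n\ge0$ and positive reals $\delta_n\to0$ such that for every $u_0\in S$, every $g\in\mathscr G$ and every $\varphi\in\mathscr L^\infty(X)$ with $\|\varphi\|_{\mathscr G\text{-Lip}}<\infty$, $$|P_{t_n}\varphi(u_0)-P_{t_n}\varphi(\tau_g(u_0))|\le2\varepsilon_0(u_0,g)\|\varphi\|_\infty+\delta_nC(u_0,g)\|\varphi\|_{\mathscr G\text{-Lip}},$$ where $C(u_0,g)<\infty$ for all $u_0\in S,g\in\mathscr G$, and $\lim_{|g|\to0}\varepsilon_0(u_0,g)=0$ for every $u_0\in S$. $\mathrm{(rAC)}_S$, for $S\subseteq X$: there exist times $t_n\ge0$ and positive reals $\delta_n\to0$ such that for every $u_0\in S$ there is $r=r(u_0)\in(0,\infty]$ such that for every $g\in B_{r(u_0)}$ and every $\varphi\in\mathscr L^\infty(X)$ with $\|\varphi\|_{\mathscr G\text{-Lip}}<\infty$ the same inequality holds, where $\varepsilon_0(u_0,g)<1$ and $C(u_0,g)<\infty$ for every $u_0\in S$, $g\in B_{r(u_0)}$. A Borel probability measure $\mu$ on $X$ is invariant for $P_t$ if $\int_XP_t\varphi\,d\mu=\int_X\varphi\,d\mu$ for all $\varphi\in\mathscr L^\infty(X)$, $t\ge0$. Radon, Borel and compact refer to the topology of $d_X$. *)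

(* Defs.v *)
From HB Require Import structures.
From mathcomp Require Import all_boot all_order all_algebra.
From mathcomp Require Import all_classical all_reals all_analysis.

Set Implicit Arguments.
Unset Strict Implicit.
Unset Printing Implicit Defensive.
Import Order.TTheory GRing.Theory Num.Theory.
Import numFieldNormedType.Exports.

Local Open Scope classical_set_scope.
Local Open Scope ring_scope.

(* Measurable types are pointed in the library, so the metric space must be
   pointed to carry its Borel sigma-algebra; a space carrying a probability
   measure is nonempty anyway. *)
#[short(type="pmetricType")]
HB.structure Definition PointedMetric (R : numDomainType) :=
  {T of Pointed T & Metric R T}.

Definition borel (X : ptopologicalType) := g_sigma_algebraType (@open X).

#[short(type="pretopologicalGroupType")]
HB.structure Definition PreTopologicalGroup := {G of Group G & Topological G}.

HB.mixin Record PreTopologicalGroup_isTopologicalGroup G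
    & PreTopologicalGroup G := {
  mulg_continuous : continuous (fun p : G * G => p.1 * p.2)%g;
  invg_continuous : continuous (fun g : G => g^-1)%g }.

#[short(type="topologicalGroupType")]
HB.structure Definition TopologicalGroup :=
  {G of PreTopologicalGroup G & PreTopologicalGroup_isTopologicalGroup G}.

Section bounded_borel_functions.
Context {R : realType} {X : pmetricType R}.

Definition Linfty (f : X -> R) : Prop :=
  measurable_fun [set: borel X] (f : borel X -> R) /\ bounded_fun f.

Definition sup_norm (f : X -> R) : R := sup [set `|f x| | x in [set: X]].

(* Only the operators P t with 0 <= t, applied to elements of Linfty, are
   constrained. *)
Record markov_semigroup (P : R -> (X -> R) -> X -> R) : Prop := {
  markov_Linfty : forall t f, 0 <= t -> Linfty f -> Linfty (P t f);
  markov_linear : forall t a f g, 0 <= t -> Linfty f -> Linfty g ->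
    P t (fun x => a * f x + g x) = (fun x => a * P t f x + P t g x);
  markov_bounded : forall t, 0 <= t ->
    exists M, forall f, Linfty f -> sup_norm (P t f) <= M * sup_norm f;
  markov_add : forall t s f, 0 <= t -> 0 <= s -> Linfty f ->
    P (t + s) f = P t (P s f) /\ P (t + s) f = P s (P t f);
  markov_ge0 : forall t f, 0 <= t -> Linfty f ->
    (forall x, 0 <= f x) -> forall x, 0 <= P t f x;
  markov_cst1 : forall t, 0 <= t -> P t (cst 1) = cst 1 }.

Definition invariant_measure (P : R -> (X -> R) -> X -> R)
    (mu : probability (borel X) R) : Prop :=
  forall t f, 0 <= t -> Linfty f ->
    (\int[mu]_x (P t f x)%:E = \int[mu]_x (f x)%:E)%E.

Definition radon (mu : probability (borel X) R) : Prop :=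
  forall A : set (borel X), measurable A ->
    mu A = ereal_sup [set mu K | K in [set K : set X | compact K /\ K `<=` A]].

Definition mutually_singular (mu nu : probability (borel X) R) : Prop :=
  exists A : set (borel X), [/\ measurable A, mu A = 0%E & nu (~` A) = 0%E].

End bounded_borel_functions.

Section group_action.
Context {R : realType} {G : topologicalGroupType} {X : pmetricType R}.

Record group_norm (nrm : G -> R) : Prop := {
  gnorm_ge0 : forall g, 0 <= nrm g;
  gnorm_eq0 : forall g, nrm g = 0 <-> g = 1%g;
  gnormV : forall g, nrm g^-1%g = nrm g;
  gnormM : forall g h, nrm (g * h)%g <= nrm g + nrm h;
  gnorm_nbhs : forall g : G,
    nbhs g = nbhs_ball_ (fun g e => [set h | nrm (g^-1 * h)%g < e]) g }.

Record group_action (tau : G -> X -> X) : Prop := {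
  act1g : forall x, tau 1%g x = x;
  actMg : forall g h x, tau (g * h)%g x = tau g (tau h x) }.

Definition gball (nrm : G -> R) (r : \bar R) : set G :=
  [set g | ((nrm g)%:E <= r)%E].

(* Suprema of nonnegative quantities are taken in [0, +oo]: there the supremum
   over an empty K is 0 and the limit is trivial, whereas [ereal_sup set0] is
   -oo, hence the restriction to nonempty K. *)
Record compatible_action (nrm : G -> R) (tau : G -> X -> X) : Prop := {
  act_small : forall K : set X, compact K -> K !=set0 ->
    ereal_sup [set ereal_sup [set (mdist x (tau g x))%:E | g in gball nrm r%:E]
              | x in K] @[r --> (0 : R)^'+] --> 0%E;
  act_measurable : forall (r : R) (K : set X), 0 <= r -> compact K ->
    measurable ([set tau g x | g in gball nrm r%:E & x in K]
                  : set (borel X)) }.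

Definition gdist (nrm : G -> R) (tau : G -> X -> X) (u v : X) : \bar R :=
  ereal_inf [set (nrm g)%:E | g in [set g | u = tau g v]].

(* The maximum with 0 only matters when X is a single point; a / +oo = 0. *)
Definition glip (nrm : G -> R) (tau : G -> X -> X) (f : X -> R) : \bar R :=
  maxe 0%E (ereal_sup
    [set (`|f p.1 - f p.2|%:E / gdist nrm tau p.1 p.2)%E
    | p in [set p : X * X | p.1 <> p.2]]).

(* [gdist] takes the value +oo and depends on [nrm] and [tau], so its topology
   is given by explicit neighborhoods instead of a canonical instance on X. *)
Definition gnbhs (nrm : G -> R) (tau : G -> X -> X) (u : X) : set_system X :=
  nbhs_ball_ (fun u (e : R) => [set v | (gdist nrm tau u v < e%:E)%E]) u.

Definition gopen (nrm : G -> R) (tau : G -> X -> X) (U : set X) : Prop :=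
  forall u, U u -> gnbhs nrm tau u U.

Definition gclosure (nrm : G -> R) (tau : G -> X -> X) (U : set X) : set X :=
  [set u | forall B, gnbhs nrm tau u B -> U `&` B !=set0].

(* The inequality shared by (rASF) and (rAC), at the point u and for the group
   element g. *)
Definition restricted_estimate (P : R -> (X -> R) -> X -> R) (nrm : G -> R)
    (tau : G -> X -> X) (t delta : nat -> R) (eps0 C : X -> G -> R)
    (u : X) (g : G) : Prop :=
  forall n f, Linfty f -> (glip nrm tau f < +oo)%E ->
    (`|P (t n) f u - P (t n) f (tau g u)|%:E
      <= (2 * eps0 u g * sup_norm f)%:E
         + (delta n * C u g)%:E * glip nrm tau f)%E.

Definition rASF (P : R -> (X -> R) -> X -> R) (nrm : G -> R)
    (tau : G -> X -> X) (S : set X) : Prop :=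
  exists (t delta : nat -> R) (eps0 C : X -> G -> R),
    [/\ forall n, 0 <= t n,
        forall n, 0 < delta n,
        delta n @[n --> \oo] --> (0 : R),
        forall u, S u -> forall g,
          restricted_estimate P nrm tau t delta eps0 C u g
      & forall u, S u -> eps0 u g @[g --> (1%g : G)^'] --> (0 : R)].

(* The data are parameters, not existentially bound, because conclusions refer
   to r and eps0. *)
Definition rAC (P : R -> (X -> R) -> X -> R) (nrm : G -> R)
    (tau : G -> X -> X) (S : set X) (t delta : nat -> R) (r : X -> \bar R)
    (eps0 C : X -> G -> R) : Prop :=
  [/\ forall n, 0 <= t n,
      forall n, 0 < delta n,
      delta n @[n --> \oo] --> (0 : R)
    & forall u, S u -> (0 < r u)%E /\
        forall g, gball nrm (r u) g ->
          eps0 u g < 1 /\ restricted_estimate P nrm tau t delta eps0 C u g].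

Definition separating_sets (nrm : G -> R) (tau : G -> X -> X)
    (mu nu : probability (borel X) R) (U0 U1 : set X) : Prop :=
  [/\ U0 `&` U1 = set0,
      gopen nrm tau U0 /\ gopen nrm tau U1,
      measurable (U0 : set (borel X)) /\ measurable (U1 : set (borel X)),
      mu U0 = 1%E /\ nu U0 = 0%E
    & mu U1 = 0%E /\ nu U1 = 1%E].

End group_action.

(* Main.v *)
Require Import Defs.
From HB Require Import structures.
From mathcomp Require Import all_boot all_order all_algebra.
From mathcomp Require Import all_classical all_reals all_analysis.
From mathcomp Require Import measurable_realfun lra.

Set Implicit Arguments.
Unset Strict Implicit.
Unset Printing Implicit Defensive.
Import Order.TTheory GRing.Theory Num.Theory.
Import numFieldNormedType.Exports.

Local Open Scope classical_set_scope.
Local Open Scope ring_scope.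

(** Two invariant measures that are mutually singular are told apart, up to a
    small error, by two disjoint compact sets K and H. The action displaces
    the points of K continuously, so no small group element carries K into H,
    and h = min (1, d(., K) / rho), with d the distance along the orbits, is a
    Lipschitz test function for that distance, equal to 0 on K and to 1 on H
    ([compact_test_function]). Its Lipschitz constant 1 / rho may be huge, but
    in the restricted estimate it is multiplied by delta n: for n large, the
    function psi = P_{t n} h satisfies
    |psi(u) - psi(tau_g u)| <= eps0 u g + small. The first term is eps0 and not
    2 eps0 because the estimate is applied to h - 1/2, of sup norm at most 1/2.
    By invariance, the integral of psi under mu and that of 1 - psi under nu
    are those of h and 1 - h, which are small ([approximate_separation]).

    Letting the errors tend to 0 in a summable way gives functions psi_m that
    tend to 0 mu-almost everywhere and to 1 nu-almost everywhere, and whose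
    asymptotic oscillation between u and tau_g u is at most eps0 u g
    ([asymptotic_separation]). Radon regularity provides sigma-compact sets W0
    and W1, of full measure for mu and nu, on which these limits hold. If
    tau_{g0} x is in W0 and tau_{g1} x is in W1, the oscillations of psi_m
    along g0 and along g1 at x add up to at least 1 ([no_bridge]). Everything
    follows from this remark. With g0 or g1 the identity, it shows that each
    point of W0 is at positive orbit distance from W1 as soon as eps0 < 1, and
    conversely; hence the sets U0 and U1 of the points at least twice closer to
    W0 than to W1, respectively to W1 than to W0, are open, disjoint, and
    contain W0 and W1. A point of both closures is at orbit distance 0 from W0
    and from W1, which the remark excludes when eps0 < 1/2. If r is infinite,
    no orbit meets both W0 and W1, and U0 is the union of the orbits that
    meet W0.

    Only orbit distances to sigma-compact sets are used, because their sublevel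
    sets are countable unions of sets tau(B_r x K) with K compact, which are
    the sets assumed to be Borel ([measurable_orbit_dist]). *)

(** * The distance along the orbits *)

Section truncated_orbit_distance.
Context {R : realType} {G : topologicalGroupType} {X : pmetricType R}.
Variables (nrm : G -> R) (tau : G -> X -> X).
Hypotheses (Hnrm : group_norm nrm) (Htau : group_action tau).

Lemma gnorm1 : nrm 1%g = 0.
Proof. exact/(gnorm_eq0 Hnrm). Qed.

Lemma actK g x : tau g^-1%g (tau g x) = x.
Proof. by rewrite -(actMg Htau) mulVg (act1g Htau). Qed.

Lemma gdist_ltP u v (e : \bar R) :
  (gdist nrm tau u v < e)%E <-> exists2 g, v = tau g u & ((nrm g)%:E < e)%E.
Proof.
split=> [/ereal_inf_lt[_ /= [g -> <-]] ge|[g -> ge]].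
  by exists g^-1%g; rewrite ?actK ?(gnormV Hnrm).
apply: le_lt_trans ge; apply: ereal_inf_lbound; exists g^-1%g => /=.
  by rewrite actK.
by rewrite (gnormV Hnrm).
Qed.

(** The increments along group elements control the quotients of [glip] at all
    pairs of points: outside a common orbit the distance is infinite and the
    quotient is 0, and two points at distance 0 have equal images, so that the
    quotient is 0 again. *)
Lemma glip_le (f : X -> R) (L : R) : 0 <= L ->
  (forall g x, `|f x - f (tau g x)| <= L * nrm g) ->
  (glip nrm tau f <= L%:E)%E.
Proof.
move=> L0 fL; rewrite /glip ge_max lee_fin L0/=.
apply: ge_ereal_sup => _ [[u v] /= _ <-].
have d0 : (0 <= gdist nrm tau u v)%E.
  by apply: le_ereal_inf_tmp => _ [g _ <-]; rewrite lee_fin (gnorm_ge0 Hnrm).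
have dlt s : (gdist nrm tau u v < s%:E)%E -> `|f u - f v| <= L * s.
  move=> /gdist_ltP[g -> gs]; apply: (le_trans (fL g u)).
  by rewrite ler_wpM2l// ltW.
case: (gdist nrm tau u v) d0 dlt => [s| |]//= s0 dlt; last first.
  by rewrite invey mule0 lee_fin.
have fs : `|f u - f v| <= L * s.
  apply/ler_addgt0Pr => e e0; have L1 : 0 < L + 1 by rewrite ltr_wpDl.
  have /dlt/le_trans : (s%:E < (s + e / (L + 1))%:E)%E.
    by rewrite lte_fin ltrDl divr_gt0.
  apply; rewrite mulrDr lerD2l mulrCA ler_piMr ?ltW//.
  by rewrite ltr_pdivrMr// mul1r ltrDl.
have [s_eq0|s_neq0] := eqVneq s 0.
  by move: fs; rewrite s_eq0 mulr0 normr_le0 => /eqP ->; rewrite normr0 mul0e.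
rewrite inver (negbTE s_neq0) -EFinM lee_fin ler_pdivrMr//.
by rewrite lt_neqAle eq_sym s_neq0.
Qed.

(** The distance from [x] to [W] along the orbit of [x], truncated at [rho]: the
    truncation makes it real-valued also when the orbit of [x] misses [W]. *)
Definition orbit_dist (rho : R) (W : set X) (x : X) : R :=
  inf [set s | s = rho \/ exists2 g, W (tau g x) & s = nrm g].

Section orbit_dist_theory.
Variables (rho : R) (rho0 : 0 <= rho) (W : set X).

Let orbit_dist_has_inf x :
  has_inf [set s | s = rho \/ exists2 g, W (tau g x) & s = nrm g].
Proof.
split; first by exists rho; left.
by exists 0 => _ [->//|[g _ ->]]; exact: gnorm_ge0.
Qed.

Lemma orbit_dist_ge0 x : 0 <= orbit_dist rho W x.
Proof.
apply: lb_le_inf; first by exists rho; left.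
by move=> _ [->//|[g _ ->]]; exact: gnorm_ge0.
Qed.

Lemma orbit_dist_le x : orbit_dist rho W x <= rho.
Proof. by apply: ge_inf; [case: (orbit_dist_has_inf x)|left]. Qed.

Lemma orbit_dist_le_norm x g : W (tau g x) -> orbit_dist rho W x <= nrm g.
Proof.
by move=> Wg; apply: ge_inf; [case: (orbit_dist_has_inf x)|right; exists g].
Qed.

Lemma orbit_dist_ltP x a : a <= rho ->
  orbit_dist rho W x < a <-> exists2 g, W (tau g x) & nrm g < a.
Proof.
move=> a_rho; split=> [|[g /orbit_dist_le_norm]]; last exact: le_lt_trans.
move=> /inf_lt[|_ [->|[g Wg ->]] ga]; last by exists g.
  by case: (orbit_dist_has_inf x).
by move: ga; rewrite ltNge a_rho.
Qed.

Lemma orbit_dist_eq0 x : W x -> orbit_dist rho W x = 0.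
Proof.
move=> Wx; apply/eqP; rewrite eq_le orbit_dist_ge0 andbT -gnorm1.
by apply: orbit_dist_le_norm; rewrite (act1g Htau).
Qed.

Lemma orbit_dist_lip g x :
  `|orbit_dist rho W x - orbit_dist rho W (tau g x)| <= nrm g.
Proof.
have oneside h y :
    orbit_dist rho W y <= orbit_dist rho W (tau h y) + nrm h.
  rewrite -lerBlDr; apply: lb_le_inf; first by exists rho; left.
  move=> _ [->|[k Wk ->]]; rewrite lerBlDr.
    by rewrite (le_trans (orbit_dist_le _))// lerDl (gnorm_ge0 Hnrm).
  apply: le_trans (gnormM Hnrm k h); apply: orbit_dist_le_norm.
  by rewrite (actMg Htau).
have := oneside g x; have := oneside g^-1%g (tau g x).
by rewrite actK (gnormV Hnrm) ler_norml => *; apply/andP; split; lra.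
Qed.

Lemma orbit_dist_far x : (forall g, nrm g < rho -> ~ W (tau g x)) ->
  orbit_dist rho W x = rho.
Proof.
move=> far; apply/eqP; rewrite eq_le orbit_dist_le leNgt.
by apply/negP => /(orbit_dist_ltP _ (lexx _))[g Wg /far].
Qed.

End orbit_dist_theory.

Hypothesis Hcomp : compatible_action nrm tau.

(** For a <= rho, the sublevel set of level a is the union over n and j of the
    sets tau(B_s x K_j) with s = a - 1/(n+1). *)
Lemma measurable_orbit_dist rho (K : nat -> set X) : 0 <= rho ->
  (forall j, compact (K j)) ->
  measurable_fun [set: borel X]
    (orbit_dist rho (\bigcup_j K j) : borel X -> R).
Proof.
move=> rho0 cK; apply: (measurability _ (RGenInftyO.measurableE R)).
move=> _ [_ [a ->] <-]; rewrite setTI.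
have [a_rho|rho_a] := leP a rho; last first.
  rewrite (_ : _ @^-1` _ = setT)//; apply/seteqP; split=> //= x _.
  by rewrite /= in_itv/=; exact: le_lt_trans (orbit_dist_le _ _ _) rho_a.
have [a0|a0] := leP a 0.
  rewrite (_ : _ @^-1` _ = set0)//; apply/seteqP; split=> //= x.
  by rewrite /= in_itv/= ltNge (le_trans a0)// orbit_dist_ge0.
(* The maximum with 0 keeps the radius in the range where the images of
   compact sets are known to be Borel. *)
pose s n : R := Num.max 0 (a - n.+1%:R^-1).
rewrite (_ : _ @^-1` _ = \bigcup_n \bigcup_j
  [set tau g x | g in gball nrm (s n)%:E & x in K j]).
  apply: bigcupT_measurable => n; apply: bigcupT_measurable => j.
  by apply: act_measurable => //; rewrite le_max lexx.
apply/seteqP; split => x /=; rewrite in_itv/=.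
  move=> /(orbit_dist_ltP rho0 _ _ a_rho)[g [j _ Kg] ga].
  have : 0 < a - nrm g by rewrite subr_gt0.
  move=> /ltr_add_invr[n]; rewrite add0r => n_lt.
  exists n => //; exists j => //; exists g^-1%g.
    rewrite /gball/= lee_fin (gnormV Hnrm) le_max; apply/orP; right.
    by rewrite lerBrDr -lerBrDl ltW.
  by exists (tau g x) => //; rewrite actK.
move=> [n _ [j _ [g gs [y Ky <-]]]].
apply/(orbit_dist_ltP rho0 _ _ a_rho); exists g^-1%g.
  by exists j => //; rewrite actK.
rewrite (gnormV Hnrm); move: gs; rewrite /gball/= lee_fin => /le_lt_trans; apply.
by rewrite gt_max a0 ltrBlDr ltrDl invr_gt0 ltr0n.
Qed.

End truncated_orbit_distance.

(** * Almost everywhere convergence, regularity and separation of compact sets *)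

(** The sum of the [psi m] has integral at most 1, hence is finite almost
    everywhere, and the general term of a convergent series tends to 0. *)
Lemma ae_cvg0_of_summable_integral d (T : measurableType d) (R : realType)
    (mu : probability T R) (psi : nat -> T -> R) :
  (forall m, measurable_fun setT (psi m)) -> (forall m x, 0 <= psi m x) ->
  (forall m, (\int[mu]_x (psi m x)%:E <= (1 / (2 ^ m.+1)%:R)%:E)%E) ->
  exists V : set T, [/\ measurable V, mu V = 1%E &
    forall x, V x -> psi m x @[m --> \oo] --> 0].
Proof.
move=> mpsi psi0 psi_le.
pose F : T -> \bar R := fun x => (\sum_(0 <= m <oo) (psi m x)%:E)%E.
have F0 x : (0 <= F x)%E by apply: nneseries_ge0 => m _ _; rewrite lee_fin.
have mF : measurable_fun setT F.
  apply: ge0_emeasurable_sum => [m x _ _|m _]; first by rewrite lee_fin.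
  exact/measurable_EFinP.
have intF : (\int[mu]_x F x <= 1)%E.
  rewrite integral_nneseries//; last 2 first.
  - by move=> m; exact/measurable_EFinP.
  - by move=> m x _; rewrite lee_fin.
  apply: le_trans (epsilon_trick0 xpredT ler01).
  apply: lee_nneseries => [m _ _|m _]; last exact: psi_le.
  by apply: integral_ge0 => x _; rewrite lee_fin.
have iF : mu.-integrable setT F.
  apply/integrableP; split => //.
  under eq_integral do rewrite gee0_abs//.
  by rewrite (le_lt_trans intF)// ltry.
pose V := [set x | (F x < +oo)%E].
have mV : measurable V.
  by rewrite -[V]setTI; exact: emeasurable_fun_infty_o.
exists V; split => //.
- have VC0 : mu (~` V) = 0%E.
    apply/negligibleP; first exact: measurableC.
    apply: negligibleS (integrable_ae measurableT iF).
    move=> x /= Vx /(_ I) Fx; apply: Vx; rewrite /V/=.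
    by move: Fx; rewrite fin_numE => /andP[_]; rewrite -ltey.
  by move: VC0; rewrite probability_setC// => /eqP; rewrite sube_eq ?fin_num_measure// add0e => /eqP.
- move=> x Vx; apply: cvg_series_cvg_0.
  by apply: nnseries_is_cvg.
Qed.

Section radon_exhaustion.
Context {R : realType} {X : pmetricType R}.

Lemma compact_measurable (K : set X) :
  compact K -> measurable (K : set (borel X)).
Proof.
move=> cK; rewrite -[K]setCK; apply: measurableC.
apply: sub_sigma_algebra; rewrite openC.
exact: compact_closed (@metric_hausdorff _ _) cK.
Qed.

Variable (mu : probability (borel X) R).
Hypothesis Rmu : radon mu.

Lemma radon_compact_approx (A : set (borel X)) (e : R) :
  measurable A -> mu A = 1%E -> 0 < e ->
  exists K : set X, [/\ compact K, K `<=` A & (mu (~` K) <= e%:E)%E].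
Proof.
move=> mA muA e0.
have : (1 - e%:E < mu A)%E by rewrite muA -EFinB lte_fin ltrBlDr ltrDl.
rewrite (Rmu mA) => /ereal_sup_gt[_ [K [cK KA] <-] Ke]; exists K; split => //.
rewrite probability_setC; last exact: compact_measurable.
move: Ke; have := probability_le1 mu (compact_measurable cK).
have := measure_ge0 mu K.
case: (mu K) => // k _ _; rewrite -!EFinB lte_fin lee_fin => ?; lra.
Qed.

Lemma radon_sigma_compact (A : set (borel X)) :
  measurable A -> mu A = 1%E ->
  exists K : nat -> set X, [/\ forall j, compact (K j),
    \bigcup_j K j `<=` A & mu (\bigcup_j K j) = 1%E].
Proof.
move=> mA muA.
have /choice[K HK] : forall n : nat, exists K : set X,
    [/\ compact K, K `<=` A & (mu (~` K) <= (n.+1%:R^-1)%:E)%E].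
  by move=> n; apply: radon_compact_approx.
have mK j : measurable (K j : set (borel X)).
  by apply: compact_measurable; case: (HK j).
exists K; split; first by move=> j; case: (HK j).
  by move=> x [j _]; case: (HK j) => _ + _; exact.
have mU : measurable (\bigcup_j K j : set (borel X)).
  exact: bigcupT_measurable.
have : mu (~` (\bigcup_j K j)) = 0%E.
  apply/eqP; rewrite eq_le measure_ge0 andbT.
  apply/lee_addgt0Pr => e e0; rewrite add0e.
  have /ltr_add_invr[n] := e0; rewrite add0r => ne.
  apply: (@le_trans _ _ (n.+1%:R^-1)%:E); last by rewrite lee_fin ltW.
  case: (HK n) => _ _; apply: le_trans; apply: le_measure; rewrite ?inE.
  - exact: measurableC.
  - exact: measurableC.
  - by apply: subsetC; exact: bigcup_sup.
by rewrite probability_setC// => /eqP; rewrite sube_eq ?fin_num_measure// add0e => /eqP.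
Qed.

End radon_exhaustion.

(** A compact set K is at positive distance from a disjoint compact set H, and
    the elements of a small ball of the group displace all points of K by less
    than that distance. *)
Lemma act_separated (R : realType) (G : topologicalGroupType)
    (X : pmetricType R) (nrm : G -> R) (tau : G -> X -> X) (K H : set X) :
  compatible_action nrm tau -> compact K -> compact H -> K `&` H = set0 ->
  exists2 rho, 0 < rho & forall g x, K x -> nrm g <= rho -> ~ H (tau g x).
Proof.
move=> Hcomp cK cH KH.
have [->|/set0P K0] := eqVneq K set0; first by exists 1.
have oH : open (~` H).
  by rewrite openC; exact: compact_closed (@metric_hausdorff _ _) cH.
have [e e0 He] : exists2 e, 0 < e & forall x, K x -> ball x e `<=` ~` H.
  have := (compact_near_coveringP K).1 cK R (0^'+)%R
    (fun e x => ball x e `<=` ~` H) _.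
  have -> : (forall x, K x ->
      \forall x' \near x & e \near 0^'+, ball x' e `<=` ~` H) = True.
    apply/propeqP; split=> // _ x Kx.
    have : nbhs x (~` H).
      by apply: open_nbhs_nbhs; split=> // Hx; rewrite -[False]/(set0 x) -KH.
    rewrite -nbhs_ballE => -[d /= d0 dH].
    exists (ball x (d / 2), [set e | e <= d / 2]) => /=.
      split; first by apply: nbhsx_ballx; rewrite divr_gt0.
      by apply: nbhs_right_ltW; rewrite divr_gt0.
    move=> [y e] /= [xy ed] z yz; apply: dH; rewrite (splitr d).
    apply: ball_triangle xy _.
    exact: le_ball ed z yz.
  move=> /(_ _ I) near0; near (0 : R)^'+ => e; exists e => //.
  exact: (near near0 e).
have := act_small Hcomp cK K0.
have eH : nbhs (0%E : \bar R) [set y | (y < e%:E)%E].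
  by apply: open_nbhs_nbhs; split; [exact: open_ereal_lt_ereal|rewrite /= lte_fin].
move=> /(_ _ eH) small0.
have small : \forall rho \near (0 : R)^'+, (ereal_sup
    [set ereal_sup [set (mdist x (tau g x))%:E | g in gball nrm rho%:E]
    | x in K] < e%:E)%E := small0.
near (0 : R)^'+ => rho; exists rho => // g x Kx grho Hg.
apply: (He x Kx (tau g x)) => //; rewrite ballEmdist /= -lte_fin.
apply: le_lt_trans (near small rho _) => //.
apply: le_trans (ereal_sup_ubound _); last by exists x.
by apply: ereal_sup_ubound; exists g.
Unshelve. all: by end_near. Qed.

(** * Test functions and Markov operators *)

Section test_functions.
Context {R : realType} {G : topologicalGroupType} {X : pmetricType R}.
Variables (nrm : G -> R) (tau : G -> X -> X).
Hypotheses (Hnrm : group_norm nrm) (Htau : group_action tau).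

Lemma Linfty_bounded (f : X -> R) (M : R) :
  measurable_fun [set: borel X] (f : borel X -> R) ->
  (forall x, `|f x| <= M) -> Linfty f.
Proof.
move=> mf fM; split=> //; exists M; split; first exact: num_real.
by move=> N MN x _; exact: le_trans (fM x) (ltW MN).
Qed.

(** The distance to [K] truncated at a radius [rho] that separates [K] from [H],
    divided by [rho]. *)
Lemma compact_test_function (K H : set X) : compatible_action nrm tau ->
  compact K -> compact H -> K `&` H = set0 ->
  exists h : X -> R, exists2 L, 0 <= L &
    [/\ measurable_fun [set: borel X] (h : borel X -> R),
        forall x, 0 <= h x <= 1,
        forall x, K x -> h x = 0,
        forall x, H x -> h x = 1
      & forall g x, `|h x - h (tau g x)| <= L * nrm g].
Proof.
move=> Hcomp cK cH KH.
have [rho rho0 sep] := act_separated Hcomp cK cH KH.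
have rho_ge0 := ltW rho0.
exists (fun x => rho^-1 * orbit_dist nrm tau rho K x), rho^-1.
  by rewrite invr_ge0.
split.
- apply: measurable_funM => //.
  have := measurable_orbit_dist Hnrm Htau Hcomp rho_ge0 (fun=> cK).
  by rewrite bigcup_const; last by exists 0%N.
- move=> x; rewrite mulr_ge0 ?invr_ge0 ?orbit_dist_ge0//=.
  by rewrite mulrC ler_pdivrMr// mul1r orbit_dist_le.
- by move=> x Kx; rewrite orbit_dist_eq0// mulr0.
- move=> x Hx; rewrite orbit_dist_far ?mulVf ?gt_eqF// => g g_rho Kg.
  apply: (sep g^-1%g (tau g x)) => //; first by rewrite (gnormV Hnrm) ltW.
  by rewrite actK.
- move=> g x; rewrite -mulrBr normrM ger0_norm ?invr_ge0//.
  by rewrite ler_wpM2l ?invr_ge0// orbit_dist_lip.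
Qed.

End test_functions.

Section markov.
Context {R : realType} {X : pmetricType R}.
Variable P : R -> (X -> R) -> X -> R.
Hypothesis HP : markov_semigroup P.

Lemma Linfty_affine (a c : R) (f : X -> R) :
  Linfty f -> Linfty (fun x => a * f x + c).
Proof.
move=> [mf [M [_ fM]]]; apply: (@Linfty_bounded _ _ _ (`|a| * (M + 1) + `|c|)).
  by apply: measurable_funD => //; exact: measurable_funM.
move=> x; apply: le_trans (ler_normD _ _) _; rewrite lerD2r normrM.
by rewrite ler_wpM2l// fM// ltrDl.
Qed.

Lemma markov_affine (s a c : R) (f : X -> R) : 0 <= s -> Linfty f ->
  P s (fun x => a * f x + c) = fun x => a * P s f x + c.
Proof.
move=> s0 Lf.
have L1 : Linfty (cst 1 : X -> R).
  by apply: (@Linfty_bounded _ _ _ 1) => // x; rewrite normr1.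
have Pc : P s (cst c) = cst c.
  have := markov_linear HP (c - 1) s0 L1 L1; rewrite (markov_cst1 HP s0).
  have -> : (fun x : X => (c - 1) * cst 1 x + cst 1 x) = cst c.
    by apply/funext => x /=; rewrite mulr1 subrK.
  by [].
have Lc : Linfty (cst c : X -> R).
  by apply: (@Linfty_bounded _ _ _ `|c|).
by have := markov_linear HP a s0 Lf Lc; rewrite Pc.
Qed.

Lemma markov_01 (s : R) (f : X -> R) : 0 <= s -> Linfty f ->
  (forall x, 0 <= f x <= 1) -> forall x, 0 <= P s f x <= 1.
Proof.
move=> s0 Lf f01 x.
rewrite (markov_ge0 HP s0 Lf) => [/=|y]; last by case/andP: (f01 y).
have := markov_ge0 HP s0 (Linfty_affine (-1) 1 Lf) _ x.
rewrite (markov_affine (-1) 1 s0 Lf) mulN1r addrC subr_ge0; apply => y.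
by rewrite mulN1r addrC subr_ge0; case/andP: (f01 y).
Qed.

(** Invariance transfers to [P s f] the bound of the integral of [f] by the
    measure of the complement of [K]. *)
Lemma integral_markov_le (mu : probability (borel X) R) (s : R) (f : X -> R)
    (K : set X) : invariant_measure P mu -> 0 <= s -> Linfty f ->
  (forall x, 0 <= f x <= 1) -> compact K -> (forall x, K x -> f x = 0) ->
  (\int[mu]_x (P s f x)%:E <= mu (~` K))%E.
Proof.
move=> Imu s0 Lf f01 cK fK; rewrite Imu//.
have mKC : measurable (~` K : set (borel X)).
  exact: measurableC (compact_measurable cK).
have := integral_indic mu measurableT mKC; rewrite setIT => <-.
apply: ge0_le_integral => //.
- by move=> x _; rewrite lee_fin; case/andP: (f01 x).
- by apply/measurable_EFinP; case: Lf.
- exact/measurable_EFinP/measurable_indic.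
- move=> x _; rewrite lee_fin indicE.
  have [/fK ->//|nK] := pselect (K x).
  by rewrite mem_set//; case/andP: (f01 x).
Qed.

End markov.

(** * Asymptotic separation of the two measures *)

Section asymptotic_separation.
Context {R : realType} {G : topologicalGroupType} {X : pmetricType R}.
Variables (nrm : G -> R) (tau : G -> X -> X).
Hypotheses (Hnrm : group_norm nrm) (Htau : group_action tau).
Variable P : R -> (X -> R) -> X -> R.
Hypothesis HP : markov_semigroup P.
Variables (t delta : nat -> R).
Hypotheses (t0 : forall n, 0 <= t n) (delta0 : forall n, 0 < delta n).

(** Subtracting the constant 1/2 from [h] changes neither the difference on the left nor
    the Lipschitz constant, and bounds the sup norm by 1/2. This cancels the
    factor 2 in front of [eps0], which is what makes the threshold
    [eps0 < 1] meaningful: two values of [P (t n) h] differ by at most 1. *)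
Lemma restricted_estimate_01 (eps0 C : X -> G -> R) u g n (h : X -> R) (L : R) :
  restricted_estimate P nrm tau t delta eps0 C u g ->
  Linfty h -> (forall x, 0 <= h x <= 1) -> 0 <= L ->
  (forall g x, `|h x - h (tau g x)| <= L * nrm g) ->
  `|P (t n) h u - P (t n) h (tau g u)|
    <= Num.max 0 (eps0 u g) + delta n * L * `|C u g|.
Proof.
move=> est Lh h01 L0 hL.
pose f x := 1 * h x - 1 / 2.
have Lf : Linfty f by exact: Linfty_affine.
have f_half x : `|f x| <= 1 / 2.
  by rewrite /f ler_norml; have /andP[? ?] := h01 x; apply/andP; split; lra.
have sup_le : sup_norm f <= 1 / 2.
  apply: ge_sup; first by exists `|f point|, point.
  by move=> _ [x _ <-].
have sup_ge : 0 <= sup_norm f.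
  apply: le_trans (normr_ge0 (f point)) _; apply: ub_le_sup; last by exists point.
  by exists (1 / 2) => _ [x _ <-].
have glip_L : (glip nrm tau f <= L%:E)%E.
  apply: (glip_le Hnrm Htau) => // k x; rewrite (_ : f x - _ = h x - h (tau k x)) ?hL// /f.
  lra.
have glip0 : (0 <= glip nrm tau f)%E by rewrite /glip le_max lexx.
have := est n f Lf (le_lt_trans glip_L (ltry _)).
have -> : P (t n) f u - P (t n) f (tau g u) = P (t n) h u - P (t n) h (tau g u).
  by rewrite (markov_affine HP _ _ (t0 n) Lh); lra.
case: (glip nrm tau f) glip0 glip_L => // l; rewrite !lee_fin => l0 lL.
move=> /le_trans; apply; apply: lerD.
  apply: (@le_trans _ _ (2 * Num.max 0 (eps0 u g) * sup_norm f)).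
    by rewrite ler_wpM2r// ler_pM2l// le_max lexx orbT.
  have : 0 <= Num.max 0 (eps0 u g) by rewrite le_max lexx.
  by move: (Num.max _ _) => e e0; nra.
rewrite -!mulrA ler_pM2l// [leRHS]mulrC.
apply: (@le_trans _ _ (`|C u g| * l)); first by rewrite ler_wpM2r// ler_norm.
by rewrite ler_wpM2l.
Qed.

Hypothesis delta_cvg : delta n @[n --> \oo] --> (0 : R).
Hypothesis Hcomp : compatible_action nrm tau.
Variables mu nu : probability (borel X) R.
Hypotheses (Rmu : radon mu) (Rnu : radon nu).
Hypotheses (Imu : invariant_measure P mu) (Inu : invariant_measure P nu).
Hypothesis Hsing : mutually_singular mu nu.

(** The compact sets are chosen first, which fixes the Lipschitz constant L of
    the test function; the time is chosen afterwards, so that delta n * L is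
    small. *)
Lemma approximate_separation (e : R) : 0 < e -> exists psi : X -> R,
  [/\ measurable_fun [set: borel X] (psi : borel X -> R),
      forall x, 0 <= psi x <= 1,
      (\int[mu]_x (psi x)%:E <= e%:E)%E,
      (\int[nu]_x (1 - psi x)%:E <= e%:E)%E
    & forall (eps0 C : X -> G -> R) u g,
        restricted_estimate P nrm tau t delta eps0 C u g ->
        `|psi u - psi (tau g u)| <= Num.max 0 (eps0 u g) + e * `|C u g|].
Proof.
move=> e0; have [A [mA muA nuA]] := Hsing.
have muAC : mu (~` A) = 1%E by rewrite probability_setC// muA sube0.
have nuA1 : nu A = 1%E.
  by rewrite -[A]setCK probability_setC ?nuA ?sube0//; exact: measurableC.
have [K [cK KA Ke]] := radon_compact_approx Rmu (measurableC mA) muAC e0.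
have [H [cH HA He]] := radon_compact_approx Rnu mA nuA1 e0.
have KH : K `&` H = set0.
  by apply/seteqP; split=> // x [/KA + /HA].
have [h [L L0 [mh h01 hK hH hL]]] :=
  compact_test_function Hnrm Htau Hcomp cK cH KH.
have Lh : Linfty h.
  apply: (Linfty_bounded (M := 1)) => // x.
  by have /andP[h0 h1] := h01 x; rewrite ger0_norm.
have [n dn] : exists n, delta n < e / (L + 1).
  have : 0 < e / (L + 1) by rewrite divr_gt0// ltr_wpDl.
  move=> /((cvgr0Pnorm_lt _).1 delta_cvg)[n _ /(_ n (leqnn n))] /ltr_normlW.
  by exists n.
have dnL : delta n * L <= e.
  move: dn; rewrite ltr_pdivlMr ?ltr_wpDl// mulrDr mulr1 => dn.
  by have := delta0 n; lra.
have [mPh _] := markov_Linfty HP (t0 n) Lh.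
exists (P (t n) h); split => //.
- exact: markov_01.
- exact: le_trans (integral_markov_le Imu (t0 n) Lh h01 cK hK) Ke.
- have L1h := Linfty_affine (-1) 1 Lh.
  under eq_integral => x _.
    have -> : 1 - P (t n) h x = P (t n) (fun y => -1 * h y + 1) x.
      by rewrite (markov_affine HP _ _ (t0 n) Lh) mulN1r addrC.
    over.
  apply: le_trans (integral_markov_le Inu (t0 n) L1h _ cH _) He => x.
    by have /andP[? ?] := h01 x; apply/andP; split; lra.
  by move=> /hH ->; rewrite mulN1r addNr.
- move=> eps0 C u g est.
  apply: le_trans (restricted_estimate_01 n est Lh h01 L0 hL) _.
  by rewrite lerD2l ler_wpM2r.
Qed.

(** The tolerances 2^-(m+1) are summable, so the convergence in mean given by
    [approximate_separation] holds almost everywhere; the sets of convergence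
    are then shrunk to sigma-compact sets, for which the distances along the
    orbits are measurable. *)
Lemma asymptotic_separation : exists (psi : nat -> X -> R) (K H : nat -> set X),
  [/\ (forall j, compact (K j)) /\ (forall j, compact (H j)),
      mu (\bigcup_j K j) = 1%E /\ nu (\bigcup_j H j) = 1%E,
      forall x, (\bigcup_j K j) x -> psi m x @[m --> \oo] --> (0 : R),
      forall x, (\bigcup_j H j) x -> psi m x @[m --> \oo] --> (1 : R)
    & forall (eps0 C : X -> G -> R) u g,
        restricted_estimate P nrm tau t delta eps0 C u g ->
        forall e, 0 < e -> \forall m \near \oo,
          `|psi m u - psi m (tau g u)| <= Num.max 0 (eps0 u g) + e].
Proof.
pose c m : R := 1 / (2 ^ m.+1)%:R.
have c0 m : 0 < c m by rewrite divr_gt0// ltr0n expn_gt0.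
have /choice[psi Hpsi] := fun m => approximate_separation (c0 m).
have mpsi m : measurable_fun [set: borel X] (psi m : borel X -> R).
  by case: (Hpsi m).
have psi01 m : forall x, 0 <= psi m x <= 1 by case: (Hpsi m).
have [V [mV muV psi_0]] : exists V : set (borel X),
    [/\ measurable V, mu V = 1%E & forall x, V x -> psi m x @[m --> \oo] --> 0].
  apply: ae_cvg0_of_summable_integral => // m; last by case: (Hpsi m).
  by move=> x; case/andP: (psi01 m x).
have [V' [mV' nuV' psi_1]] : exists V : set (borel X),
    [/\ measurable V, nu V = 1%E &
        forall x, V x -> 1 - psi m x @[m --> \oo] --> 0].
  apply: ae_cvg0_of_summable_integral => m; last by case: (Hpsi m).
    exact: measurable_funB.
  by move=> x; rewrite subr_ge0; case/andP: (psi01 m x).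
have [K [cK KV muK]] := radon_sigma_compact Rmu mV muV.
have [H [cH HV nuH]] := radon_sigma_compact Rnu mV' nuV'.
exists psi, K, H; split => //.
- by move=> x /KV; exact: psi_0.
- move=> x /HV/psi_1 cvg1; rewrite -(subr0 1).
  rewrite (_ : (fun m => psi m x) = (fun m => 1 - (1 - psi m x))).
    by apply: cvgB cvg1; exact: cvg_cst.
  by apply/funext => m; rewrite subKr.
- move=> eps0 C u g est e e0.
  have c_cvg : c m * `|C u g| @[m --> \oo] --> (0 : R).
    rewrite -(mul0r `|C u g|); apply: cvgMl.
    rewrite (_ : c = geometric 2^-1 2^-1).
      by apply: cvg_geometric; rewrite ger0_norm ?invr_ge0// invf_lt1// ltr1n.
    by apply/funext => m; rewrite /c /= natrX exprS invfM exprVn mul1r.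
  apply: filterS ((cvgr0Pnorm_lt _).1 c_cvg e e0) => m cm.
  have [_ _ _ _ /(_ _ _ _ _ est) /le_trans] := Hpsi m; apply.
  by rewrite lerD2l ltW// (le_lt_trans (ler_norm _) cm).
Qed.

End asymptotic_separation.

(** * Points closer to one set than to another *)

Lemma measurable_lt d (T : measurableType d) (R : realType) (f g : T -> R) :
  measurable_fun setT f -> measurable_fun setT g ->
  measurable [set x | f x < g x].
Proof.
move=> mf mg; have := measurable_fun_ltr mf mg measurableT (Y := [set true]).
by rewrite setTI; apply.
Qed.

Lemma probability_disjoint0 d (T : measurableType d) (R : realType)
    (mu : probability T R) (A B : set T) : measurable A -> measurable B ->
  A `&` B = set0 -> mu A = 1%E -> mu B = 0%E.
Proof.
move=> mA mB AB muA; have mAC := measurableC mA.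
have muAC : mu (~` A) = 0%E by rewrite probability_setC// muA subee.
apply/eqP; rewrite eq_le measure_ge0 andbT -muAC le_measure ?inE// => x Bx Ax.
by rewrite -[False]/(set0 x) -AB.
Qed.

Lemma probability_superset1 d (T : measurableType d) (R : realType)
    (mu : probability T R) (A B : set T) : measurable A -> measurable B ->
  A `<=` B -> mu A = 1%E -> mu B = 1%E.
Proof.
move=> mA mB AB muA; apply/eqP; rewrite eq_le probability_le1//=.
by rewrite -muA le_measure ?inE.
Qed.

Section separating_sets_construction.
Context {R : realType} {G : topologicalGroupType} {X : pmetricType R}.
Variables (nrm : G -> R) (tau : G -> X -> X).
Hypotheses (Hnrm : group_norm nrm) (Htau : group_action tau).

(** The factor 2 keeps the closures of [closer_to W W'] and [closer_to W' W]
    apart, except at the points where both distances vanish. *)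
Definition closer_to (W W' : set X) : set X :=
  [set x | 2 * orbit_dist nrm tau 1 W x < orbit_dist nrm tau 1 W' x].

Lemma closer_to_disjoint W W' : closer_to W W' `&` closer_to W' W = set0.
Proof.
apply/seteqP; split => // x [] /=; rewrite /closer_to/=.
have := orbit_dist_ge0 tau Hnrm (@ler01 R) W x; lra.
Qed.

Lemma gopen_closer_to W W' : gopen nrm tau (closer_to W W').
Proof.
move=> x /= xW; rewrite /closer_to/= in xW.
exists ((orbit_dist nrm tau 1 W' x - 2 * orbit_dist nrm tau 1 W x) / 3).
  by rewrite /= divr_gt0// subr_gt0.
move=> v /= /(gdist_ltP Hnrm Htau)[g -> ]; rewrite lte_fin /closer_to /=.
have := orbit_dist_lip Hnrm Htau (@ler01 R) W g x.
have := orbit_dist_lip Hnrm Htau (@ler01 R) W' g x.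
by rewrite !ler_norml => /andP[? ?] /andP[? ?] ?; lra.
Qed.

Lemma gclosure_closer_to W W' x : gclosure nrm tau (closer_to W W') x ->
  2 * orbit_dist nrm tau 1 W x <= orbit_dist nrm tau 1 W' x.
Proof.
move=> clx; apply/ler_addgt0Pr => e e0.
have [|v []] := clx [set v | (gdist nrm tau x v < (e / 3)%:E)%E].
  by exists (e / 3) => //=; rewrite divr_gt0.
rewrite /closer_to/= => vW /(gdist_ltP Hnrm Htau)[g v_eq]; move: vW.
rewrite v_eq lte_fin.
have := orbit_dist_lip Hnrm Htau (@ler01 R) W g x.
have := orbit_dist_lip Hnrm Htau (@ler01 R) W' g x.
by rewrite !ler_norml => /andP[? ?] /andP[? ?] ? ?; lra.
Qed.

Variable psi : nat -> X -> R.

(** The superior limit over m of |psi_m(u) - psi_m(tau_g u)| is at most [M]. *)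
Definition oscillation_le (u : X) (g : G) (M : R) : Prop :=
  forall e, 0 < e -> \forall m \near \oo,
    `|psi m u - psi m (tau g u)| <= M + e.

Lemma oscillation_le1 u : oscillation_le u 1%g 0.
Proof.
move=> e e0; near=> m.
by rewrite (act1g Htau) subrr normr0 add0r ltW.
Unshelve. all: by end_near. Qed.

Variables W0 W1 : set X.
Hypothesis psi0 : forall x, W0 x -> psi m x @[m --> \oo] --> (0 : R).
Hypothesis psi1 : forall x, W1 x -> psi m x @[m --> \oo] --> (1 : R).

(** Going from tau_{g0} x to tau_{g1} x through x, the values of psi_m have to
    increase from 0 to 1. *)
Lemma no_bridge x g0 g1 M0 M1 : W0 (tau g0 x) -> W1 (tau g1 x) ->
  oscillation_le x g0 M0 -> oscillation_le x g1 M1 -> 1 <= M0 + M1.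
Proof.
move=> /psi0/cvgrPdist_le cvg0 /psi1/cvgrPdist_le cvg1 osc0 osc1.
apply/ler_addgt0Pr => e e0; have e4 : 0 < e / 4 by rewrite divr_gt0.
near \oo => m.
have : `|0 - psi m (tau g0 x)| <= e / 4 by near: m; exact: cvg0.
have : `|1 - psi m (tau g1 x)| <= e / 4 by near: m; exact: cvg1.
have : `|psi m x - psi m (tau g0 x)| <= M0 + e / 4 by near: m; exact: osc0.
have : `|psi m x - psi m (tau g1 x)| <= M1 + e / 4 by near: m; exact: osc1.
by rewrite !ler_norml => /andP[? ?] /andP[? ?] /andP[? ?] /andP[? ?]; lra.
Unshelve. all: by end_near. Qed.

Definition locally_oscillates_lt (c : R) : Prop := forall u,
  exists2 rho, 0 < rho & forall g, nrm g <= rho ->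
    exists2 M, M < c & oscillation_le u g M.

Lemma orbit_dist_gt0 (W : set X) (u : X) (rho : R) : 0 < rho ->
  (forall g, nrm g <= rho -> ~ W (tau g u)) -> 0 < orbit_dist nrm tau 1 W u.
Proof.
move=> rho0 far; rewrite ltNge; apply/negP => d0.
have m0 : 0 < Num.min 1 rho by rewrite lt_min ltr01.
have : orbit_dist nrm tau 1 W u < Num.min 1 rho by exact: le_lt_trans d0 m0.
move=> /(orbit_dist_ltP tau Hnrm (@ler01 R))[|g Wg]; first by rewrite ge_min lexx.
by rewrite lt_min => /andP[_ /ltW /far].
Qed.

Lemma sub_closer_to0 : locally_oscillates_lt 1 -> W0 `<=` closer_to W0 W1.
Proof.
move=> osc x Wx; rewrite /closer_to/= orbit_dist_eq0// mulr0.
have [rho rho0 Hrho] := osc x; apply: (orbit_dist_gt0 rho0) => g /Hrho[M M1 oscM].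
rewrite -(act1g Htau x) in Wx; move=> Wg.
by have := no_bridge Wx Wg (oscillation_le1 x) oscM; rewrite add0r leNgt M1.
Qed.

Lemma sub_closer_to1 : locally_oscillates_lt 1 -> W1 `<=` closer_to W1 W0.
Proof.
move=> osc x Wx; rewrite /closer_to/= orbit_dist_eq0// mulr0.
have [rho rho0 Hrho] := osc x; apply: (orbit_dist_gt0 rho0) => g /Hrho[M M1 oscM].
rewrite -(act1g Htau x) in Wx; move=> Wg.
by have := no_bridge Wg Wx oscM (oscillation_le1 x); rewrite addr0 leNgt M1.
Qed.

(** At a common point x of the closures both distances vanish, so arbitrarily
    small elements carry x into W0 and into W1; each contributes an oscillation
    below 1/2. *)
Lemma gclosure_closer_to_disjoint : locally_oscillates_lt (1 / 2) ->
  gclosure nrm tau (closer_to W0 W1) `&` gclosure nrm tau (closer_to W1 W0)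
    = set0.
Proof.
move=> osc; apply/seteqP; split => // x [/gclosure_closer_to d0 /gclosure_closer_to d1].
have [rho rho0 Hrho] := osc x.
have near_W W : orbit_dist nrm tau 1 W x <= 0 ->
    exists2 g, nrm g <= rho & W (tau g x).
  move=> dW; apply: contrapT => far; move: dW; apply/negP; rewrite -ltNge.
  by apply: (orbit_dist_gt0 rho0) => g grho Wg; apply: far; exists g.
have ge0 W := orbit_dist_ge0 tau Hnrm (@ler01 R) W x.
have [|g0 /Hrho[M0 M0_lt osc0] W0g] := near_W W0.
  by have := ge0 W0; lra.
have [|g1 /Hrho[M1 M1_lt osc1] W1g] := near_W W1.
  by have := ge0 W1; lra.
by have := no_bridge W0g W1g osc0 osc1; lra.
Qed.

End separating_sets_construction.

(** * From the restricted estimate to the separating sets *)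

Section restricted_conditions.
Context {R : realType} {G : topologicalGroupType} {X : pmetricType R}.
Variables (P : R -> (X -> R) -> X -> R) (nrm : G -> R) (tau : G -> X -> X).
Hypotheses (Hnrm : group_norm nrm) (Htau : group_action tau).

(** What the two restricted conditions have in common: the estimate holds, with
    a constant below [c], for all elements of a ball that depends on the point.
    The functions [eps0] and [C] may vary with the group element, which allows
    for a separate choice at the identity. *)
Definition locally_estimated (t delta : nat -> R) (c : R) : Prop := forall u,
  exists2 rho, 0 < rho & forall g, nrm g <= rho ->
    exists eps0 C : X -> G -> R, eps0 u g < c /\
      restricted_estimate P nrm tau t delta eps0 C u g.

Lemma rAC_locally_estimated t delta r eps0 C c :
  rAC P nrm tau [set: X] t delta r eps0 C ->
  (forall u g, gball nrm (r u) g -> eps0 u g < c) ->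
  locally_estimated t delta c.
Proof.
move=> [_ _ _ rac] eps_c u; have [r0 est] := rac u I.
have [rho rho0 rho_r] : exists2 rho : R, 0 < rho & (rho%:E <= r u)%E.
  by case: (r u) r0 => // [s|_]; [exists s|exists 1; rewrite ?leey].
exists rho => // g g_rho.
have rg : gball nrm (r u) g.
  by rewrite /gball/=; apply: le_trans rho_r; rewrite lee_fin.
by exists eps0, C; split; [exact: eps_c|case: (est g rg)].
Qed.

Lemma restricted_estimate1 t delta u :
  restricted_estimate P nrm tau t delta (fun _ _ => 0) (fun _ _ => 0) u 1%g.
Proof.
move=> n f _ _; rewrite (act1g Htau) subrr normr0 !mulr0 mul0r mul0e.
by rewrite adde0.
Qed.

(** The limit of [eps0 u g] as [g] tends to 1 does not constrain [eps0 u 1]; at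
    the identity the estimate holds with zero constants instead. *)
Lemma rASF_locally_estimated c : 0 < c -> rASF P nrm tau [set: X] ->
  exists t delta : nat -> R, [/\ forall n, 0 <= t n, forall n, 0 < delta n,
    delta n @[n --> \oo] --> (0 : R) & locally_estimated t delta c].
Proof.
move=> c0 [t [delta [eps0 [C [t0 delta0 delta_cvg est eps_cvg]]]]].
exists t, delta; split=> // u.
have : nbhs (1%g : G) [set g | g != 1%g -> `|eps0 u g| < c] :=
  (cvgr0Pnorm_lt _).1 (eps_cvg u I) c c0.
rewrite (gnorm_nbhs Hnrm) => -[d /= d0 dP].
exists (d / 2); first by rewrite divr_gt0.
move=> g gd; have [->|g1] := eqVneq g 1%g.
  by exists (fun _ _ => 0), (fun _ _ => 0); split=> //; exact: restricted_estimate1.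
exists eps0, C; split; last exact: est.
by apply/ltr_normlW/dP => //=; rewrite invg1 mul1g; lra.
Qed.

Lemma locally_estimated_oscillates t delta c (psi : nat -> X -> R) : 0 < c ->
  (forall (eps0 C : X -> G -> R) u g,
    restricted_estimate P nrm tau t delta eps0 C u g ->
    oscillation_le tau psi u g (Num.max 0 (eps0 u g))) ->
  locally_estimated t delta c -> locally_oscillates_lt nrm tau psi c.
Proof.
move=> c0 osc loc u; have [rho rho0 Hrho] := loc u.
exists rho => // g /Hrho[eps0 [C [eps_c /osc]]].
by exists (Num.max 0 (eps0 u g)); first rewrite gt_max c0.
Qed.

End restricted_conditions.

Section separation.
Context {R : realType} {G : topologicalGroupType} {X : pmetricType R}.
Variables (nrm : G -> R) (tau : G -> X -> X).
Hypotheses (Hnrm : group_norm nrm) (Htau : group_action tau).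
Hypothesis Hcomp : compatible_action nrm tau.
Variable P : R -> (X -> R) -> X -> R.
Hypothesis HP : markov_semigroup P.
Variables mu nu : probability (borel X) R.
Hypotheses (Rmu : radon mu) (Rnu : radon nu).
Hypotheses (Imu : invariant_measure P mu) (Inu : invariant_measure P nu).
Hypothesis Hsing : mutually_singular mu nu.
Variables (t delta : nat -> R).
Hypotheses (t0 : forall n, 0 <= t n) (delta0 : forall n, 0 < delta n).
Hypothesis delta_cvg : delta n @[n --> \oo] --> (0 : R).

Lemma measurable_sigma_compact (K : nat -> set X) :
  (forall j, compact (K j)) -> measurable (\bigcup_j K j : set (borel X)).
Proof.
by move=> cK; apply: bigcupT_measurable => j; exact: compact_measurable.
Qed.

(** The two sets do not depend on whether the oscillations are below 1/2; only
    the disjointness of their closures does. *)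
Lemma locally_estimated_separation : locally_estimated P nrm tau t delta 1 ->
  exists U0 U1 : set X, separating_sets nrm tau mu nu U0 U1 /\
    (locally_estimated P nrm tau t delta (1 / 2) ->
      gclosure nrm tau U0 `&` gclosure nrm tau U1 = set0).
Proof.
move=> loc.
have [psi [K [H [[cK cH] [muK nuH] psi0 psi1 osc]]]] := asymptotic_separation
  Hnrm Htau HP t0 delta0 delta_cvg Hcomp Rmu Rnu Imu Inu Hsing.
set W0 := \bigcup_j K j in muK psi0; set W1 := \bigcup_j H j in nuH psi1.
have osc1 := locally_estimated_oscillates ltr01 osc loc.
have mW0 : measurable (W0 : set (borel X)) by exact: measurable_sigma_compact.
have mW1 : measurable (W1 : set (borel X)) by exact: measurable_sigma_compact.
have mcloser (W W' : set X) : (W = W0 \/ W = W1) -> (W' = W0 \/ W' = W1) ->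
    measurable (closer_to nrm tau W W' : set (borel X)).
  have mdist W'' : (W'' = W0 \/ W'' = W1) ->
      measurable_fun [set: borel X] (orbit_dist nrm tau 1 W'' : borel X -> R).
    by move=> [->|->]; exact: measurable_orbit_dist.
  move=> WP WP'; apply: measurable_lt; last exact: mdist.
  by apply: measurable_funM => //; exact: mdist.
have mU0 : measurable (closer_to nrm tau W0 W1 : set (borel X)).
  by apply: mcloser; [left|right].
have mU1 : measurable (closer_to nrm tau W1 W0 : set (borel X)).
  by apply: mcloser; [right|left].
have muU0 : mu (closer_to nrm tau W0 W1) = 1%E.
  by apply: probability_superset1 muK => //; exact: sub_closer_to0 osc1.
have nuU1 : nu (closer_to nrm tau W1 W0) = 1%E.
  by apply: probability_superset1 nuH => //; exact: sub_closer_to1 osc1.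
exists (closer_to nrm tau W0 W1), (closer_to nrm tau W1 W0); split.
  split; [exact: closer_to_disjoint| | by [] | |].
  - by split; exact: gopen_closer_to.
  - split=> //; apply: probability_disjoint0 nuU1 => //.
    exact: closer_to_disjoint.
  - split=> //; apply: probability_disjoint0 muU0 => //.
    exact: closer_to_disjoint.
move=> loc2; apply: (gclosure_closer_to_disjoint Hnrm Htau psi0 psi1).
by apply: locally_estimated_oscillates osc loc2; rewrite divr_gt0.
Qed.

(** When all group elements satisfy the estimate, an orbit cannot meet both W0
    and W1, and the union of the orbits that meet W0 is invariant, hence open
    together with its complement. It is Borel as the increasing union over n of
    the sets of points at orbit distance less than n from W0. *)
Lemma globally_estimated_separation :
  (forall u g, exists eps0 C : X -> G -> R, eps0 u g < 1 /\
    restricted_estimate P nrm tau t delta eps0 C u g) ->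
  exists U0 : set X, separating_sets nrm tau mu nu U0 (~` U0) /\
    [set tau g x | g in [set: G] & x in U0] = U0.
Proof.
move=> glob.
have [psi [K [H [[cK cH] [muK nuH] psi0 psi1 osc]]]] := asymptotic_separation
  Hnrm Htau HP t0 delta0 delta_cvg Hcomp Rmu Rnu Imu Inu Hsing.
set W0 := \bigcup_j K j in muK psi0; set W1 := \bigcup_j H j in nuH psi1.
have mW0 : measurable (W0 : set (borel X)) by exact: measurable_sigma_compact.
have mW1 : measurable (W1 : set (borel X)) by exact: measurable_sigma_compact.
pose U := [set x | exists g, W0 (tau g x)].
have Uact g x : U (tau g x) <-> U x.
  split=> -[h]; first by rewrite -(actMg Htau); exists (h * g)%g.
  by exists (h * g^-1)%g; rewrite (actMg Htau) (actK Htau).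
have mU : measurable (U : set (borel X)).
  have -> : U = \bigcup_(n in [set: nat])
      [set x | orbit_dist nrm tau n%:R W0 x < n%:R].
    apply/seteqP; split=> [x [g Wg]|x [n _ /= ]]; last first.
      by move=> /(orbit_dist_ltP tau Hnrm (ler0n _ _) _ _ (lexx _))[g]; exists g.
    exists (Num.bound (nrm g)) => //=.
    apply: le_lt_trans (orbit_dist_le_norm Hnrm (ler0n _ _) Wg) _.
    by apply: archi_boundP; exact: (gnorm_ge0 Hnrm).
  apply: bigcupT_measurable => n; apply: measurable_lt => //.
  exact: measurable_orbit_dist.
have muU : mu U = 1%E.
  apply: probability_superset1 muK => // x Wx; exists 1%g.
  by rewrite (act1g Htau).
have nuUC : nu (~` U) = 1%E.
  apply: probability_superset1 nuH => //; first exact: measurableC.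
  move=> x W1x [g W0g]; have [eps0 [C [eps1 est]]] := glob x g.
  have W1x1 : W1 (tau 1%g x) by rewrite (act1g Htau).
  have := no_bridge psi0 psi1 W0g W1x1 (osc _ _ _ _ est)
    (oscillation_le1 Htau psi x).
  by rewrite addr0 leNgt gt_max ltr01 eps1.
exists U; split; last first.
  apply/seteqP; split=> [_ [g _ [x Ux <-]]|x Ux]; first by apply/Uact.
  by exists 1%g => //; exists x => //; exact: act1g.
split.
- exact: setICr.
- split=> u Uu; exists 1 => //= v /(gdist_ltP Hnrm Htau)[g -> _].
    exact/Uact.
  by move=> /Uact.
- by split=> //; exact: measurableC.
- by split=> //; apply: probability_disjoint0 nuUC; rewrite ?setICl//;
    exact: measurableC.
- by split=> //; apply: probability_disjoint0 muU; rewrite ?setICr//;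
    exact: measurableC.
Qed.

End separation.

Theorem theorem2p6 (R : realType) (X : pmetricType R)
  (P : R -> (X -> R) -> X -> R) (HP : markov_semigroup P)
  (G : topologicalGroupType) (nrm : G -> R) (Hnrm : group_norm nrm)
  (tau : G -> X -> X) (Htau : group_action tau)
  (Hcomp : compatible_action nrm tau)
  (t delta : nat -> R) (r : X -> \bar R) (eps0 C : X -> G -> R)
  (HrAC : rAC P nrm tau [set: X] t delta r eps0 C)
  (mu nu : probability (borel X) R)
  (Rmu : radon mu) (Rnu : radon nu)
  (Imu : invariant_measure P mu) (Inu : invariant_measure P nu)
  (Hsing : mutually_singular mu nu) :
  (exists U0 U1 : set X,
    [/\ separating_sets nrm tau mu nu U0 U1,
        (forall u g, gball nrm (r u) g -> eps0 u g < 1 / 2) ->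
          gclosure nrm tau U0 `&` gclosure nrm tau U1 = set0
      & rASF P nrm tau [set: X] ->
          gclosure nrm tau U0 `&` gclosure nrm tau U1 = set0])
  /\
  ((forall u, r u = +oo%E) ->
    exists U0 : set X,
      separating_sets nrm tau mu nu U0 (~` U0) /\
      [set tau g x | g in [set: G] & x in U0] = U0).
Proof.
have [t0 delta0 delta_cvg rac] := HrAC.
have eps1 u g : gball nrm (r u) g -> eps0 u g < 1.
  by move=> /(rac u I).2[].
split; last first.
  move=> r_oo; apply: (globally_estimated_separation Hnrm Htau Hcomp HP Rmu Rnu
    Imu Inu Hsing t0 delta0 delta_cvg) => u g.
  have ug : gball nrm (r u) g by rewrite /gball/= r_oo leey.
  by exists eps0, C; split; [exact: eps1|have [_ /(_ g ug)[]] := rac u I].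
(* The condition of the last conclusion comes with its own times, unrelated to
   those of the coupling property. When it holds, it is used to construct the
   sets, and then the closures are disjoint in any case. *)
have [asf|nasf] := pselect (rASF P nrm tau [set: X]).
  have half0 : 0 < 1 / 2 :> R by rewrite divr_gt0.
  have [t' [delta' [t0' delta0' delta_cvg' loc]]] :=
    rASF_locally_estimated Hnrm Htau half0 asf.
  have [|U0 [U1 [sep /(_ loc) closures]]] := locally_estimated_separation Hnrm
    Htau Hcomp HP Rmu Rnu Imu Inu Hsing t0' delta0' delta_cvg'.
    move=> u; have [rho rho0 Hrho] := loc u; exists rho => // g.
    move=> /Hrho[e [c [e_half est]]]; exists e, c; split=> //; lra.
  by exists U0, U1.
have [U0 [U1 [sep closures]]] := locally_estimated_separation Hnrm Htau Hcomp HP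
  Rmu Rnu Imu Inu Hsing t0 delta0 delta_cvg (rAC_locally_estimated HrAC eps1).
exists U0, U1; split=> // eps_half.
exact/closures/(rAC_locally_estimated HrAC).
Qed.
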